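(* Let $d\ge2$ be an integer, $0<\xi\le1$ and $\vartheta\in[1,d]$. Let $\mathrm{val}(\mathcal L_\rho)$ be the infimum of $$\int_{\mathbb S_+}\big(u_1^\xi+\cdots+u_d^\xi\big)^{1/\xi}H(d\boldsymbol u)$$ over all finite Borel measures $H$ on $\mathbb S_+$ satisfying $$\int_{\mathbb S_+}u_j\,H(d\boldsymbol u)=1,\ j=1,\dots,d,\qquad\text{and}\qquad\int_{\mathbb S_+}\max_{j=1,\dots,d}u_j\,H(d\boldsymbol u)=\vartheta.$$ Let $B_k=[d(k+1)^{-1},dk^{-1})$ for $k=2,\dots,d-1$ and $B_1=[d/2,d]$. Then $\mathrm{val}(\mathcal L_\rho)$ is given by the piecewise linear function $$\mathrm{val}(\mathcal L_\rho)=L(\vartheta):=\sum_{k=1}^{d-1}\mathbf 1_{B_k}(\vartheta)\left\{\frac{k^{1/\xi-1}-(k+1)^{1/\xi-1}}{k^{-1}-(k+1)^{-1}}\Big(\vartheta-\frac d{k+1}\Big)+d(k+1)^{1/\xi-1}\right\}.$$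
   Context: $\mathbb S_+=\{\boldsymbol u\in[0,\infty)^d:\sum_{i=1}^du_i=1\}$ is the unit simplex; $\mathbf 1_B$ is the indicator function of the set $B$; all measures are non-negative. *)

(* Defs.v *)
From HB Require Import structures.
From mathcomp Require Import all_boot all_order all_algebra.
From mathcomp Require Import all_classical all_reals all_analysis.

Set Implicit Arguments.
Unset Strict Implicit.
Unset Printing Implicit Defensive.

Import Order.TTheory GRing.Theory Num.Theory.
Import numFieldNormedType.Exports.

Local Open Scope classical_set_scope.
Local Open Scope ring_scope.

Definition borelRd (R : realType) (d : nat) :=
  g_sigma_algebraType (@open 'rV[R]_d).

Definition simplex (R : realType) (d : nat) : set 'rV[R]_d :=
  [set u | (forall i, 0 <= u 0 i) /\ \sum_(i < d) u 0 i = 1].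
Arguments simplex : clear implicits.

(* The default value 0 is harmless: it is only used at points with
   nonnegative coordinates. *)
Definition maxcoord (R : realType) (d : nat) (u : 'rV[R]_d) : R :=
  \big[Num.max/0]_(j < d) u 0 j.

Definition cost (R : realType) (d : nat) (xi : R) (u : 'rV[R]_d) : R :=
  (\sum_(i < d) u 0 i `^ xi) `^ (xi^-1).

(* The simplex S is closed, so its Borel sets are the Borel subsets of R^d
   contained in S, and a finite Borel measure on S is the same thing as a
   finite Borel measure on R^d that does not charge the complement of S. *)
Definition feasible (R : realType) (d : nat) (theta : R) :=
  [set H : {finite_measure set (borelRd R d) -> \bar R} |
   [/\ H (~` simplex R d) = 0%E,
    (forall j : 'I_d, (\int[H]_(u in simplex R d) (u 0 j)%:E = 1)%E) &
    (\int[H]_(u in simplex R d) (maxcoord u)%:E = theta%:E)%E]].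
Arguments feasible {R} d theta.

Definition val_Lrho (R : realType) (d : nat) (xi theta : R) : \bar R :=
  ereal_inf [set (\int[H]_(u in simplex R d) (cost xi u)%:E)%E
            | H in feasible d theta].

Definition B (R : realType) (d k : nat) : set R :=
  if k == 1%N then `[d%:R / 2, d%:R]%classic
  else `[d%:R / k.+1%:R, d%:R / k%:R[%classic.
Arguments B : clear implicits.

Definition L (R : realType) (d : nat) (xi theta : R) : R :=
  \sum_(1 <= k < d) \1_(B R d k) theta *
    ((k%:R `^ (xi^-1 - 1) - k.+1%:R `^ (xi^-1 - 1)) / (k%:R^-1 - k.+1%:R^-1)
       * (theta - d%:R / k.+1%:R)
     + d%:R * k.+1%:R `^ (xi^-1 - 1)).

(* Main.v *)
(** Put p = 1/xi >= 1 and D_j = (j+1)^p - j^p, which is nondecreasing in j.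
    Listing the coordinates of u in decreasing order u_(0) >= u_(1) >= ...,
    convexity of t^p gives cost(u) >= sum_j u_(j) D_j.  Subtracting D_k from
    every D_j and discarding the nonnegative terms yields the linear minorant
      cost(u) >= D_k * sum_i u_i + (k^p - k D_k) * max_i u_i,
    whose integral is D_k d + (k^p - k D_k) theta for every feasible H.
    Equality holds at the normalised indicators of sets of k or k+1
    coordinates; a mixture of the d cyclic shifts of each kind is feasible when
    d/(k+1) <= theta <= d/k. *)

Require Import Defs.
From HB Require Import structures.
From mathcomp Require Import all_boot all_order all_algebra.
From mathcomp Require Import all_classical all_reals all_analysis.
From mathcomp Require Import measurable_realfun ring lra.

Set Implicit Arguments.
Unset Strict Implicit.
Unset Printing Implicit Defensive.

Import Order.TTheory GRing.Theory Num.Theory.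
Import numFieldNormedType.Exports.

Local Open Scope classical_set_scope.
Local Open Scope ring_scope.

(** * Convexity of powers and the pointwise lower bound *)

Lemma powR_convex (R : realType) (p t x y : R) :
  1 <= p -> 0 <= t <= 1 -> 0 <= x -> 0 <= y ->
  (t * x + (1 - t) * y) `^ p <= t * x `^ p + (1 - t) * y `^ p.
Proof.
move=> p1 /andP[t0 t1] x0 y0.
have := @convex_powR R p p1 (Itv01 t0 t1) x y.
rewrite !convRE /= /unstable.onem; apply.
- by rewrite inE /= in_itv /= x0.
- by rewrite inE /= in_itv /= y0.
Qed.

(** Both [y] and [x + v] lie between [x] and [y + v], with the weights [t] and [1 - t] swapped.
    Adding the two convexity inequalities gives the claim. *)
Lemma powR_increment_le (R : realType) (p x y v : R) :
  1 <= p -> 0 <= x -> x <= y -> 0 <= v ->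
  (x + v) `^ p - x `^ p <= (y + v) `^ p - y `^ p.
Proof.
move=> p1 x0 xy; rewrite le_eqVlt => /predU1P[<-|v0]; first by rewrite !addr0 !subrr.
have w0 : 0 < y + v - x by lra.
pose t := v / (y + v - x).
have t01 : 0 <= t <= 1.
  by rewrite divr_ge0 ?(ltW v0) ?(ltW w0) //= ler_pdivrMr //; lra.
have t01' : 0 <= 1 - t <= 1 by case/andP: t01 => ? ?; apply/andP; split; lra.
have yv0 : 0 <= y + v by lra.
have := powR_convex p1 t01 x0 yv0.
have := powR_convex p1 t01' x0 yv0.
have -> : t * x + (1 - t) * (y + v) = y by rewrite /t; field; rewrite gt_eqF.
have -> : (1 - t) * x + (1 - (1 - t)) * (y + v) = x + v.
  by rewrite /t; field; rewrite gt_eqF.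
lra.
Qed.

Definition powR_step (R : realType) (p : R) (j : nat) : R :=
  j.+1%:R `^ p - j%:R `^ p.

Lemma powR_step_ge0 (R : realType) (p : R) j : 0 <= p -> 0 <= powR_step p j.
Proof.
by move=> p0; rewrite subr_ge0 ge0_ler_powR ?nnegrE ?ler0n // ler_nat.
Qed.

Lemma powR_step_homo (R : realType) (p : R) i j :
  1 <= p -> (i <= j)%N -> powR_step p i <= powR_step p j.
Proof.
move=> p1 ij; rewrite /powR_step -!natr1.
by apply: powR_increment_le; rewrite ?ler0n ?ler_nat.
Qed.

Lemma sum_powR_step (R : realType) (p : R) n :
  p != 0 -> \sum_(j < n) powR_step p j = n%:R `^ p.
Proof.
move=> p0; rewrite -(big_mkord xpredT (powR_step p)).
by rewrite telescope_sumr // powR0 // subr0.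
Qed.

(* Appending an element [x] below all others raises the l^xi quasi-norm by at
   least [x * powR_step xi^-1 (size s)]: by convexity of [powR], the increment
   is smallest when all previous elements equal [x]. *)
Lemma qnorm_decreasing_ge (R : realType) (xi b M : R) (s : seq R) :
  0 < xi -> xi <= 1 -> pairwise >=%R s -> all (fun x => 0 <= x <= M) s ->
  b * (\sum_(x <- s) x)
    + M * (\sum_(j < size s) Num.min (powR_step xi^-1 j - b) 0)
  <= (\sum_(x <- s) x `^ xi) `^ xi^-1.
Proof.
move=> xi0 xi1; set p := xi^-1.
have p1 : 1 <= p by rewrite /p invf_ge1.
have xip : xi * p = 1 by rewrite /p divff // gt_eqF.
elim/last_ind: s => [|s x IH].
  by rewrite /= !big_nil big_ord0 !mulr0 addr0 powR_ge0.
rewrite pairwise_rcons all_rcons size_rcons => /andP[sx sorts].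
move=> /andP[/andP[x0 xM] sM].
rewrite -!cats1 !big_cat /= !big_seq1 big_ord_recr /=.
have {IH} := IH sorts sM.
set S := \sum_(y <- s) y; set m := \sum_(_ < _) _; set T := \sum_(y <- s) _.
set D := powR_step p (size s) => IH.
have T_ge : (size s)%:R * x `^ xi <= T.
  rewrite /T; elim: (s) sx => [|y s' IHs] /=; first by rewrite big_nil mul0r.
  move=> /andP[xy /IHs]; rewrite big_cons -nat1r mulrDl mul1r; apply: lerD.
  by rewrite ge0_ler_powR ?nnegrE ?(ltW xi0) // (le_trans x0).
have xp z : 0 <= z -> (z * x `^ xi) `^ p = z `^ p * x.
  by move=> z0; rewrite powRM ?powR_ge0 // -powRrM xip powRr1.
have step : x * D <= (T + x `^ xi) `^ p - T `^ p.
  have := @powR_increment_le R p _ _ (x `^ xi) p1 _ T_ge (powR_ge0 _ _).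
  rewrite mulr_ge0 ?ler0n ?powR_ge0 // => /(_ isT); apply: le_trans.
  rewrite -[X in _ * _ + X]mul1r -mulrDl natr1 !xp ?ler0n //.
  by rewrite -mulrBl mulrC.
(* If [D - b] is nonpositive, replacing [x] by the larger [M] only lowers the product; otherwise the
   left side is 0. *)
have min_le : M * Num.min (D - b) 0 <= x * (D - b).
  have [Db|Db] := leP (D - b) 0.
    by rewrite ler_wnM2r.
  by rewrite mulr0 mulr_ge0 // ltW.
rewrite mulrDr mulrDr; nra.
Qed.

(* The affine function [j |-> slope p k + powR_step p k * j] interpolates
   [j |-> j `^ p] at [k] and [k.+1]. *)
Definition slope (R : realType) (p : R) k : R := k%:R `^ p - k%:R * powR_step p k.

(** Monotonicity of the steps makes the terms with [j >= k] vanish, while those with [j < k]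
    telescope to the slope. *)
Lemma slope_le_sum_min (R : realType) (p : R) n k :
  1 <= p -> (k <= n)%N ->
  slope p k <= \sum_(j < n) Num.min (powR_step p j - powR_step p k) 0.
Proof.
move=> p1 kn; have p0 : p != 0 by rewrite gt_eqF // (lt_le_trans _ p1).
rewrite -(big_mkord xpredT (fun j => Num.min (powR_step p j - powR_step p k) 0)).
rewrite (big_cat_nat (leq0n k) kn) /= [X in _ + X]big1_seq ?addr0; last first.
  move=> j /andP[_]; rewrite mem_index_iota => /andP[kj _].
  by rewrite min_r // subr_ge0 powR_step_homo.
rewrite big_mkord /slope -sum_powR_step //.
have -> : k%:R * powR_step p k = \sum_(j < k) powR_step p k.
  by rewrite sumr_const card_ord mulr_natl.
rewrite -sumrB; apply: ler_sum => j _.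
by rewrite le_min lexx subr_le0 powR_step_homo // ltnW.
Qed.

Lemma slope_le0 (R : realType) (p : R) k : 1 <= p -> slope p k <= 0.
Proof.
move=> p1; apply: (le_trans (@slope_le_sum_min R p k k p1 (leqnn k))).
by apply: sumr_le0 => j _; rewrite ge_min lexx orbT.
Qed.

Lemma maxcoord_ge0 (R : realType) (d : nat) (u : 'rV[R]_d) : 0 <= maxcoord u.
Proof. exact: bigmax_ge_id. Qed.

(** All three quantities are symmetric in the coordinates, so [qnorm_decreasing_ge] applies to the
    sorted list with [M] the largest coordinate. *)
Lemma cost_ge (R : realType) (d k : nat) (xi : R) (u : 'rV[R]_d) :
  0 < xi -> xi <= 1 -> (k <= d)%N -> (forall i, 0 <= u 0 i) ->
  powR_step xi^-1 k * (\sum_(i < d) u 0 i) + slope xi^-1 k * maxcoord u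
  <= cost xi u.
Proof.
move=> xi0 xi1 kd u0.
pose s := sort >=%R [seq u 0 i | i <- enum 'I_d].
have sperm : perm_eq [seq u 0 i | i <- enum 'I_d] s by rewrite perm_sym perm_sort.
have sumE (F : R -> R) : \sum_(i < d) F (u 0 i) = \sum_(x <- s) F x.
  by rewrite -(perm_big _ sperm) /= big_map big_enum.
have size_s : size s = d by rewrite size_sort size_map size_enum_ord.
have M0 := maxcoord_ge0 u.
rewrite /cost (sumE (@powR R ^~ xi)) (sumE id).
have := @qnorm_decreasing_ge R xi (powR_step xi^-1 k) (maxcoord u) s xi0 xi1.
rewrite size_s; move=> H; apply: le_trans (H _ _).
- rewrite lerD2l mulrC ler_wpM2l // slope_le_sum_min //.
  by rewrite invf_ge1.
- rewrite -sorted_pairwise; last by move=> x y z /= yx /le_trans; apply.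
  by apply: sort_sorted => x y; exact: le_total.
- rewrite -(perm_all _ sperm) all_map; apply/allP => i _ /=.
  by rewrite u0; apply: le_bigmax.
Qed.

(** * Measurability of the integrands and of the simplex *)

Lemma measurable_coord (R : realType) (d : nat) (i : 'I_d) :
  measurable_fun [set: borelRd R d] (fun u : borelRd R d => (u : 'rV[R]_d) 0 i).
Proof.
apply: (measurability _ (RGenOpens.measurableE R)) => _ [_ [a [b ->]] <-].
rewrite setTI; apply: sub_sigma_algebra.
have /continuousP := @coord_continuous R 1 d 0 i; apply; exact: interval_open.
Qed.

Lemma measurable_maxcoord (R : realType) (d : nat) :
  measurable_fun [set: borelRd R d] (@maxcoord R d).
Proof.
rewrite /maxcoord; elim: (index_enum _) => [|i s IH].
  by under eq_fun do rewrite big_nil; exact: measurable_cst.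
under eq_fun do rewrite big_cons.
exact: measurable_maxr (measurable_coord i) IH.
Qed.

Lemma measurable_cost (R : realType) (d : nat) (xi : R) :
  measurable_fun [set: borelRd R d] (@cost R d xi).
Proof.
apply: (measurableT_comp (measurable_powR _)).
apply: (@measurable_sum _ _ _ _ _ _ (fun i (u : borelRd R d) => (u : 'rV[R]_d) 0 i `^ xi)) => i.
exact: (measurableT_comp (measurable_powR _) (measurable_coord i)).
Qed.

Lemma measurable_simplex (R : realType) (d : nat) :
  measurable (simplex R d : set (borelRd R d)).
Proof.
have -> : simplex R d =
    (\bigcap_(i in [set: 'I_d]) ((fun u : 'rV[R]_d => u 0 i) @^-1` `[0, +oo[))
    `&` (fun u : 'rV[R]_d => \sum_(i < d) u 0 i) @^-1` [set 1].
  apply/seteqP; split=> u [u0 u1]; split=> // i.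
    by move=> _ /=; rewrite in_itv /= u0.
  by have := u0 i Logic.I; rewrite /= in_itv /= andbT.
apply: (@measurableI _ (borelRd R d)).
  apply: (@fin_bigcap_measurable _ (borelRd R d)) => // i _.
  rewrite -[X in measurable X]setTI; exact: measurable_coord.
rewrite -[X in measurable X]setTI.
have := @measurable_sum _ (borelRd R d) R setT 'I_d (index_enum 'I_d)
  (fun i (u : borelRd R d) => (u : 'rV[R]_d) 0 i) (@measurable_coord R d).
by apply => //; exact: measurable_set1.
Qed.

(** * Finite combinations of Dirac measures *)

Section atomic.
Context d (T : measurableType d) (R : realType).
Variables (w : nat -> {nonneg R}) (x : nat -> T) (n : nat).

Definition atomic : set T -> \bar R :=
  msum (fun i => mscale (w i) (dirac (x i))) n.

HB.instance Definition _ := Measure.on atomic.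

Lemma atomicE A : atomic A = (\sum_(i < n) (w i)%:num%:E * \d_(x i) A)%E.
Proof. by []. Qed.

Let atomic_fin_num : fin_num_fun atomic.
Proof.
move=> A mA; rewrite atomicE; apply/sum_fin_numP => i _ _.
by rewrite fin_numM // fin_num_measure.
Qed.

HB.instance Definition _ := Measure_isFinite.Build _ _ _ atomic atomic_fin_num.

Lemma integral_atomic (D : set T) (f : T -> R) :
  measurable D -> (forall i, (i < n)%N -> D (x i)) ->
  (forall t, D t -> 0 <= f t) -> measurable_fun D f ->
  (\int[atomic]_(t in D) (f t)%:E)%E = (\sum_(i < n) (w i)%:num * f (x i))%:E.
Proof.
move=> mD Dx f0 mf; have mf' : measurable_fun D (EFin \o f) by exact/measurable_EFinP.
rewrite ge0_integral_measure_sum // -sumEFin; apply: eq_bigr => i _.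
rewrite ge0_integral_mscale // integral_dirac // diracE mem_set ?mul1e //.
exact: Dx.
Qed.

End atomic.

(** * Lower bound for every feasible measure *)

(** The slope is nonpositive, so the [maxcoord] term is moved to the side of the cost. Both
    integrands are then nonnegative, and additivity and monotonicity for nonnegative functions
    suffice. *)
Lemma integral_cost_ge (R : realType) (d k : nat) (xi theta : R)
    (H : {finite_measure set (borelRd R d) -> \bar R}) :
  0 < xi -> xi <= 1 -> (k <= d)%N -> feasible d theta H ->
  ((slope xi^-1 k * theta + powR_step xi^-1 k * d%:R)%:E
    <= \int[H]_(u in simplex R d) (cost xi u)%:E)%E.
Proof.
move=> xi0 xi1 kd [_ Hcoord Hmax].
set a := slope _ _; set b := powR_step _ _.
have p1 : 1 <= xi^-1 by rewrite invf_ge1.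
have a0 : 0 <= - a by rewrite oppr_ge0 slope_le0.
have b0 : 0 <= b by rewrite powR_step_ge0 // (le_trans _ p1).
pose S : set (borelRd R d) := simplex R d.
have mS : measurable S := @measurable_simplex R d.
have mF (f : borelRd R d -> R) :
    measurable_fun setT f -> measurable_fun S (EFin \o f).
  by move=> mf; apply/measurable_EFinP; exact: measurable_funTS.
have mmax := mF _ (@measurable_maxcoord R d).
have mcost := mF _ (@measurable_cost R d xi).
have mcoord j := mF _ (@measurable_coord R d j).
have Ib : (\int[H]_(u in S) (\sum_(j < d) b%:E * (u 0 j)%:E) = (b * d%:R)%:E)%E.
  rewrite ge0_integral_sum //.
  - under eq_bigr => j _.
      rewrite ge0_integralZl_EFin //; [|by move=> u [u0 _]; rewrite lee_fin u0|exact: mcoord].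
      rewrite Hcoord mule1; over.
    by rewrite sumEFin sumr_const card_ord mulr_natr.
  - by move=> j; exact: measurable_funeM (mcoord j).
  - by move=> j u [u0 _]; rewrite -EFinM lee_fin mulr_ge0.
have Ic : (\int[H]_(u in S) ((cost xi u)%:E + (- a)%:E * (maxcoord u)%:E)
    = \int[H]_(u in S) (cost xi u)%:E + (- a * theta)%:E)%E.
  rewrite ge0_integralD //.
  - rewrite ge0_integralZl_EFin ?Hmax // => u _; by rewrite lee_fin maxcoord_ge0.
  - by move=> u _; rewrite lee_fin powR_ge0.
  - by move=> u _; rewrite -EFinM lee_fin mulr_ge0 // maxcoord_ge0.
  - exact: measurable_funeM mmax.
have : ((b * d%:R)%:E <= \int[H]_(u in S) (cost xi u)%:E + (- a * theta)%:E)%E.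
  rewrite -Ib -Ic; apply: ge0_le_integral => //.
  - by move=> u [u0 _]; apply: sume_ge0 => j _; rewrite -EFinM lee_fin mulr_ge0.
  - by apply: emeasurable_sum => j; exact: measurable_funeM (mcoord j).
  - by apply: emeasurable_funD => //; exact: measurable_funeM mmax.
  - move=> u [u0 u1]; under eq_bigr do rewrite -EFinM.
    rewrite sumEFin -EFinM -EFinD lee_fin -mulr_sumr.
    by have := cost_ge xi0 xi1 kd u0; rewrite -/a -/b; lra.
rewrite mulNr EFinN leeBrDr // -EFinD addrC; exact.
Qed.

(** * Extremal points and an optimal measure *)

(** For [0 < k <= d] this is the barycentre of a face of the simplex, with support a cyclic window
    of [k] indices. Letting [j] run through all shifts treats the coordinates equally. *)
Definition cyc (R : realType) (d k j : nat) : 'rV[R]_d :=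
  \row_(i < d) (if ((i + j) %% d < k)%N then k%:R^-1 else 0).

Lemma sum_cyclic_shift (R : realType) (d j : nat) (F : nat -> R) :
  \sum_(i < d) F ((i + j) %% d)%N = \sum_(i < d) F i.
Proof.
case: d => [|d]; first by rewrite !big_ord0.
pose h (i : 'I_d.+1) : 'I_d.+1 := inord ((i + j) %% d.+1).
have hE i : h i = ((i + j) %% d.+1)%N :> nat by rewrite inordK // ltn_mod.
rewrite [RHS](reindex_inj (h := h)) /=; first by apply: eq_bigr => i _; rewrite hE.
move=> i i' /(congr1 val); rewrite /= !hE => /eqP.
by rewrite eqn_modDr !modn_small // => /eqP /val_inj.
Qed.

Lemma sum_prefix (R : realType) (d k : nat) (c : R) :
  (k <= d)%N -> \sum_(i < d) (if (i < k)%N then c else 0) = k%:R * c.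
Proof.
move=> kd; rewrite -big_mkcond -(big_ord_widen d (fun=> c) kd).
by rewrite sumr_const card_ord mulr_natl.
Qed.

Lemma sum_cyc (R : realType) (d k j : nat) (F : R -> R) :
  F 0 = 0 -> (k <= d)%N -> \sum_(i < d) F (cyc R d k j 0 i) = k%:R * F k%:R^-1.
Proof.
move=> F0 kd; rewrite -(sum_prefix (F k%:R^-1) kd).
rewrite -(sum_cyclic_shift d j (fun i => if (i < k)%N then _ else _)).
by apply: eq_bigr => i _; rewrite mxE; case: ifP.
Qed.

(** The entry depends on [i + j] only, so summing over shifts amounts to summing over
    coordinates. *)
Lemma sum_cyc_shifts (R : realType) (d k : nat) (i : 'I_d) :
  (0 < k <= d)%N -> \sum_(j < d) cyc R d k j 0 i = 1.
Proof.
move=> /andP[k0 kd]; rewrite -(@divff _ (k%:R : R)) ?pnatr_eq0 -?lt0n //.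
rewrite -(sum_prefix k%:R^-1 kd).
rewrite -(sum_cyclic_shift d i (fun j => if (j < k)%N then _ else _)).
by apply: eq_bigr => j _; rewrite mxE addnC.
Qed.

Lemma cyc_simplex (R : realType) (d k j : nat) :
  (0 < k <= d)%N -> simplex R d (cyc R d k j).
Proof.
move=> /andP[k0 kd]; split; first by move=> i; rewrite mxE; case: ifP.
by rewrite (sum_cyc j (F := id)) // divff // pnatr_eq0 -lt0n.
Qed.

Lemma maxcoord_cyc (R : realType) (d k j : nat) :
  (0 < k <= d)%N -> (j < d)%N -> maxcoord (cyc R d k j) = k%:R^-1.
Proof.
move=> /andP[k0 kd] jd; have d0 : (0 < d)%N by exact: leq_trans kd.
apply/eqP; rewrite eq_le; apply/andP; split.
  by apply: bigmax_le => [|i _]; rewrite ?mxE //; case: ifP.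
(* This index is shifted to 0 and so lies in the window; the reduction modulo [d] handles
   [j = 0]. *)
pose i : 'I_d := Ordinal (ltn_pmod (d - j) d0).
apply: le_trans (le_bigmax _ _ i); rewrite mxE /= modnDml subnK ?(ltnW jd) //.
by rewrite modnn k0.
Qed.

Lemma cost_cyc (R : realType) (d k j : nat) (xi : R) :
  0 < xi -> (0 < k <= d)%N -> cost xi (cyc R d k j) = k%:R `^ xi^-1 / k%:R.
Proof.
move=> xi0 /andP[k0 kd].
rewrite /cost (sum_cyc j (F := @powR R ^~ xi)) ?powR0 ?gt_eqF //.
rewrite powRM ?powR_ge0 // -powRrM divff ?gt_eqF // powRr1 //.
Qed.

Lemma sum_maxcoord_cyc (R : realType) (d k : nat) :
  (0 < k <= d)%N -> \sum_(j < d) maxcoord (cyc R d k j) = d%:R / k%:R.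
Proof.
move=> kd; under eq_bigr do rewrite maxcoord_cyc //.
by rewrite sumr_const card_ord mulr_natl.
Qed.

Lemma sum_cost_cyc (R : realType) (d k : nat) (xi : R) :
  0 < xi -> (0 < k <= d)%N ->
  \sum_(j < d) cost xi (cyc R d k j) = d%:R * (k%:R `^ xi^-1 / k%:R).
Proof.
move=> xi0 kd; under eq_bigr do rewrite cost_cyc //.
by rewrite sumr_const card_ord mulr_natl.
Qed.

Lemma feasible_attains (R : realType) (d k : nat) (xi theta : R) :
  0 < xi -> (0 < k < d)%N -> d%:R / k.+1%:R <= theta <= d%:R / k%:R ->
  exists2 H, feasible d theta H &
    (\int[H]_(u in simplex R d) (cost xi u)%:E
      = (slope xi^-1 k * theta + powR_step xi^-1 k * d%:R)%:E)%E.
Proof.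
move=> xi0 /andP[k0 kd] /andP[theta_ge theta_le].
have d0 : 0 < d%:R :> R by rewrite ltr0n (leq_trans _ kd).
have kR0 : 0 < k%:R :> R by rewrite ltr0n.
have k1 : (0 < k <= d)%N by rewrite k0 ltnW.
have k2 : (0 < k.+1 <= d)%N by [].
(* [t] solves [t * (d / k) + (1 - t) * (d / k.+1) = theta]. *)
pose t := k%:R * (k.+1%:R * theta / d%:R - 1).
have t0 : 0 <= t.
  rewrite mulr_ge0 // subr_ge0 ler_pdivlMr // mul1r.
  by rewrite mulrC -ler_pdivrMr ?ltr0n.
have t1 : 0 <= 1 - t.
  have : k%:R * theta / d%:R <= 1.
    by rewrite ler_pdivrMr // mul1r mulrC -ler_pdivlMr.
  have -> : 1 - t = (k.+1%:R) * (1 - k%:R * theta / d%:R).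
    by rewrite /t -natr1; ring.
  by move=> h; rewrite mulr_ge0 // subr_ge0.
have thetaE : t * (d%:R / k%:R) + (1 - t) * (d%:R / k.+1%:R) = theta.
  by rewrite /t -natr1; field; rewrite !gt_eqF //= addr_gt0.
have costE : t * (d%:R * (k%:R `^ xi^-1 / k%:R))
    + (1 - t) * (d%:R * (k.+1%:R `^ xi^-1 / k.+1%:R))
    = slope xi^-1 k * theta + powR_step xi^-1 k * d%:R.
  rewrite /t /slope /powR_step -natr1.
  by field; rewrite !gt_eqF //= addr_gt0.
(* The first [d] atoms are the shifts with support size [k], of mass [t] each; the next [d] have
   support size [k.+1] and mass [1 - t]. *)
pose w (i : nat) : {nonneg R} := if (i < d)%N then NngNum t0 else NngNum t1.
pose x (i : nat) : borelRd R d :=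
  if (i < d)%N then cyc R d k i else cyc R d k.+1 (i - d).
pose H : {finite_measure set (borelRd R d) -> \bar R} := atomic w x (d + d).
have xS i : simplex R d (x i).
  by rewrite /x; case: ifP => _; exact: cyc_simplex.
have mS := @measurable_simplex R d.
have intE (f : 'rV[R]_d -> R) :
    (forall u, simplex R d u -> 0 <= f u) ->
    measurable_fun [set: borelRd R d] (f : borelRd R d -> R) ->
    (\int[H]_(u in simplex R d) (f u)%:E =
     (t * \sum_(j < d) f (cyc R d k j) + (1 - t) * \sum_(j < d) f (cyc R d k.+1 j))%:E)%E.
  move=> f0 mf; rewrite integral_atomic //; last exact: measurable_funTS.
  rewrite big_split_ord /= !mulr_sumr; congr (_ + _)%:E; apply: eq_bigr => j _.
    by rewrite /w /x ltn_ord.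
  by rewrite /w /x ltnNge leq_addr /= addKn.
exists H.
  split.
  - rewrite /H /= atomicE big1 // => i _.
    by rewrite diracE memNset ?mule0 // => /(_ (xS i)).
  - move=> j; rewrite intE; last exact: measurable_coord.
      by rewrite !sum_cyc_shifts //; apply: (congr1 EFin); ring.
    by move=> u [].
  - rewrite intE; [|by move=> u _; exact: maxcoord_ge0|exact: measurable_maxcoord].
    by rewrite !sum_maxcoord_cyc // thetaE.
rewrite intE; [|by move=> u _; exact: powR_ge0|exact: measurable_cost].
by rewrite -costE; congr (_ * _ + _ * _)%:E; exact: sum_cost_cyc.
Qed.

(** * The linear piece of [L] that is active at [theta] *)

(** The index is the least positive [k] with [d / k.+1 <= theta]. *)
Lemma B_itv (R : realType) (d : nat) (theta : R) :
  (2 <= d)%N -> 1 <= theta -> theta <= d%:R ->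
  exists k, [/\ (0 < k < d)%N, d%:R / k.+1%:R <= theta <= d%:R / k%:R &
    forall j, (0 < j < d)%N -> B R d j theta <-> j = k].
Proof.
move=> d2 theta1 thetad.
(* The witness [d.-1] works because d/d = 1 is at most [theta]. *)
have ex : exists k, (0 < k)%N && (d%:R / k.+1%:R <= theta).
  by exists d.-1; rewrite -ltnS prednK ?(ltnW d2) // d2 divff // pnatr_eq0 -lt0n ltnW.
case: (ex_minnP ex) => k /andP[k0 kle] kmin.
have kd : (k < d)%N.
  rewrite (@leq_ltn_trans d.-1) ?prednK ?(ltnW d2) //.
  apply: kmin; rewrite -ltnS prednK ?(ltnW d2) // d2 divff // pnatr_eq0 -lt0n ltnW //.
(* Otherwise [k.-1] would contradict minimality. For [k = 1] the bound is not strict, which matches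
   the closed right end of the first interval. *)
have klt : k != 1%N -> theta < d%:R / k%:R.
  move=> k1; rewrite ltNge; apply/negP => h.
  have := kmin k.-1; rewrite prednK // h andbT -ltnS prednK //.
  rewrite ltn_neqAle eq_sym k1 k0 => /(_ isT).
  by rewrite leqNgt ltn_predL k0.
exists k; split; rewrite ?k0 //.
  rewrite kle /=; have [->|/klt/ltW//] := eqVneq k 1%N; by rewrite divr1.
move=> j /andP[j0 jd].
split=> [|->]; last first.
  rewrite /B; case: eqVneq => [k1|/klt h]; rewrite /= in_itv /=.
    by rewrite k1 in kle; rewrite kle.
  by rewrite kle.
rewrite /B => Bj.
have [jle jlt] : d%:R / j.+1%:R <= theta /\ (j = 1%N \/ theta < d%:R / j%:R).
  by move: Bj; case: eqVneq => [->|_]; rewrite /= in_itv /= => /andP[]; auto.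
have kj : (k <= j)%N by apply: kmin; rewrite j0.
(* If [k < j], then d/j is at most d/(k+1), hence at most [theta], against the strict upper end of
   the interval for [j]. *)
apply/eqP; rewrite eqn_leq kj andbT leqNgt; apply/negP => ltkj.
case: jlt => [j1|]; first by move: ltkj; rewrite j1 ltnS leqNgt k0.
rewrite ltNge => /negP; apply; apply: le_trans kle.
by rewrite ler_wpM2l // lef_pV2 ?posrE ?ltr0n // ler_nat.
Qed.

Lemma L_affine (R : realType) (d : nat) (xi theta : R) :
  (2 <= d)%N -> 0 < xi -> 1 <= theta -> theta <= d%:R ->
  exists k, [/\ (0 < k < d)%N, d%:R / k.+1%:R <= theta <= d%:R / k%:R &
    L d xi theta = slope xi^-1 k * theta + powR_step xi^-1 k * d%:R].
Proof.
move=> d2 xi0 theta1 thetad.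
have [k [kd theta_itv Bk]] := B_itv d2 theta1 thetad.
exists k; split => //; rewrite /L.
rewrite (bigD1_seq k) ?iota_uniq ?mem_index_iota //= big1_seq ?addr0; last first.
  move=> j /andP[jk]; rewrite mem_index_iota => jd.
  by rewrite indicE memNset ?mul0r // => /(Bk j jd)/eqP; exact/negP.
rewrite indicE mem_set ?mul1r; last exact/(Bk k kd).
have k0 : 0 < k%:R :> R by rewrite ltr0n; case/andP: kd.
have k_neq0 : k%:R != 0 :> R by rewrite gt_eqF.
(* Writing k^(p-1) as k^p / k, and likewise for k+1, turns the goal into a rational identity in k,
   k^p and (k+1)^p. *)
rewrite !powRD ?k_neq0 ?pnatr_eq0 ?implybT //.
rewrite !powR_inv1 // /slope /powR_step -natr1.
field; rewrite !gt_eqF /=; lra.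
Qed.

Theorem theorem3p7 (R : realType) (d : nat) (xi theta : R)
  (hd : (2 <= d)%N) (hxi0 : 0 < xi) (hxi1 : xi <= 1)
  (htheta1 : 1 <= theta) (hthetad : theta <= d%:R) :
  val_Lrho d xi theta = (L d xi theta)%:E.
Proof.
have [k [kd theta_itv ->]] := L_affine hd hxi0 htheta1 hthetad.
apply/eqP; rewrite eq_le; apply/andP; split.
  have [H fH <-] := feasible_attains hxi0 kd theta_itv.
  by apply: ereal_inf_lbound; exists H.
apply: le_ereal_inf_tmp => _ [H fH <-]; apply: integral_cost_ge => //.
by case/andP: kd => _ /ltnW.
Qed.
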